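(* Let $G=(V,A)$ be a flow graph with start vertex $s$, let $F$ be a depth-first spanning tree of $G$ rooted at $s$ with vertices identified with their preorder numbers $1,\dots,n$, and let $f(v)$ be the parent of $v$ in $F$. For each $v\neq s$ let $\mathit{sd}(v)$, $\mathit{rd}(v)$ and $g(v)$ be as defined below. Process the vertices $v\neq s$ in increasing order: if $\mathit{sd}(v)=\mathit{sd}(\mathit{rd}(v))$ or $b(\mathit{rd}(v))=f(\mathit{rd}(v))$, set $b(v)=g(v)$ and $r(v)=f(v)$; otherwise set $b(v)=f(v)$ and $r(v)=g(v)$. Let $B$ (resp. $R$) be the graph with vertex set $V$ and arcs $(b(v),v)$ (resp. $(r(v),v)$) for $v\neq s$. Then both $B$ and $R$ are spanning trees rooted at $s$.
   Context: A flow graph is a finite directed graph $G=(V,A)$ with start vertex $s$ such that every vertex is reachable from $s$; there are no arcs entering $s$ and $n=|V|>1$. A path from $u$ to $v$ is high if all its vertices other than $u$ and $v$ are greater (in the preorder numbering of $F$) than both $u$ and $v$. For $v\neq s$, the semi-dominator $\mathit{sd}(v)$ is the minimum vertex $u$ such that there is a high path from $u$ to $v$. For $v\neq s$, $F(\mathit{sd}(v),v]$ denotes the path in $F$ from the child of $\mathit{sd}(v)$ that is an ancestor of $v$ down to $v$; the relative dominator $\mathit{rd}(v)$ is the vertex $x$ on $F(\mathit{sd}(v),v]$ with $\mathit{sd}(x)$ minimum, ties broken in favor of the smallest $x$. For each $v\neq s$, $(g(v),v)\in A$ is an arc that is the last arc on some high path from $\mathit{sd}(v)$ to $v$. *)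

(* Defs.v *)
From mathcomp Require Import all_boot.

Set Implicit Arguments.
Unset Strict Implicit.
Unset Printing Implicit Defensive.

Section Defs.

Variable V : finType.

Record flow_graph (A : rel V) (s : V) : Prop := FlowGraph {
  flow_card : 1 < #|V|;
  flow_start : forall u, ~~ A u s;
  flow_reach : forall v, connect A s v
}.

(* Rooted trees and forests are given by parent maps V -> option V, with value
   None at a root; parent_arc p is the set of arcs (p(v), v). *)
Definition parent_arc (p : V -> option V) : rel V :=
  fun u v => p v == Some u.

Definition set_parent (p : V -> option V) (v : V) (u : option V) :
  V -> option V := fun w => if w == v then u else p w.

Record spanning_tree (A : rel V) (s : V) (T : rel V) : Prop := SpanningTree {
  tree_sub : subrel T A;
  tree_root : forall u, ~~ T u s;
  tree_parent : forall v, v != s -> exists! u, T u v;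
  tree_reach : forall v, connect T s v
}.

(* dfs_run A s stk ord f: some depth-first search of A from s reaches the state
   in which stk is the stack of active vertices (current vertex first), ord
   lists the visited vertices in order of first visit, and f is the parent map
   built so far. *)
Inductive dfs_run (A : rel V) (s : V) :
    seq V -> seq V -> (V -> option V) -> Prop :=
  | DfsStart : dfs_run A s [:: s] [:: s] (fun=> None)
  | DfsAdvance u v stk ord f :
      dfs_run A s (u :: stk) ord f -> A u v -> v \notin ord ->
      dfs_run A s [:: v, u & stk] (rcons ord v) (set_parent f v (Some u))
  | DfsRetreat u stk ord f :
      dfs_run A s (u :: stk) ord f -> (forall v, A u v -> v \in ord) ->
      dfs_run A s stk ord f.

Definition dfs_tree (A : rel V) (s : V) (ord : seq V) (f : V -> option V) :
  Prop := dfs_run A s [::] ord f.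

Definition preorder (ord : seq V) (v : V) : nat := (index v ord).+1.

(* The path is u, p, v; "vertices other than u and v" are those of p, so an
   interior vertex is distinct from both ends. Without this, a closed walk
   through v could be appended to a high path to v. *)
Definition high_path (A : rel V) (ord : seq V) (u : V) (p : seq V) (v : V) :
  bool :=
  path A u (rcons p v) &&
  all (fun w => (preorder ord u < preorder ord w) &&
                (preorder ord v < preorder ord w)) p.

Definition is_semidominator (A : rel V) (ord : seq V) (v u : V) : Prop :=
  (exists p, high_path A ord u p v) /\
  (forall w p, high_path A ord w p v -> preorder ord u <= preorder ord w).

(* x lies on F(u, v], for the tree F with parent map f. *)
Definition on_tree_path (f : V -> option V) (u v x : V) : Prop :=
  exists c, [/\ parent_arc f u c, connect (parent_arc f) c x
              & connect (parent_arc f) x v].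

Definition is_relative_dominator (ord : seq V) (f : V -> option V)
    (sd : V -> V) (v x : V) : Prop :=
  on_tree_path f (sd v) v x /\
  forall y, on_tree_path f (sd v) v y ->
    preorder ord (sd x) < preorder ord (sd y) \/
    (sd x = sd y /\ preorder ord x <= preorder ord y).

Definition is_last_high_arc (A : rel V) (ord : seq V) (u v w : V) : Prop :=
  exists2 p, high_path A ord u p v & w = last u p.

Definition assign_step (f : V -> option V) (sd rd g : V -> V)
    (br : (V -> option V) * (V -> option V)) (v : V) :
    (V -> option V) * (V -> option V) :=
  let: (b, r) := br in
  if (sd v == sd (rd v)) || (b (rd v) == f (rd v)) then
    (set_parent b v (Some (g v)), set_parent r v (f v))
  else
    (set_parent b v (f v), set_parent r v (Some (g v))).

(* ord is already increasing in preorder number. *)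
Definition assign (s : V) (ord : seq V) (f : V -> option V)
    (sd rd g : V -> V) : (V -> option V) * (V -> option V) :=
  foldl (assign_step f sd rd g) (fun=> None, fun=> None)
        [seq v <- ord | v != s].

End Defs.

(* Main.v *)
Require Import Defs.
From mathcomp Require Import all_boot.

(** Whether [b v] is [g v] or [f v] is a boolean [T v] with [T v = ~~ T (rd v)]
    unless [sd (rd v) = sd v], and [R] is obtained by exchanging the two values.
    Suppose the chosen arcs contain a cycle and let [v] be its smallest vertex.
    All vertices of the cycle are descendants of [v], and every [z] on a tree
    path from [v] to the cycle, [z <> v], satisfies [sd v <= sd z], since it
    reaches [v] through vertices larger than [v].  Among such [z] with
    [sd z < v], the vertex [rd z] is an ancestor of [v] determined by [sd z];
    an induction along [rd] then shows that [T z = T v] holds exactly for [sd z]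
    below some threshold.  Hence "some [x] on the tree path from [v] to [y],
    [x <> v], has [sd x < v] and [T x = T v]" holds at the predecessor of [v] on
    the cycle and is inherited by predecessors, so it holds at [v], where it is
    absurd. *)

Set Implicit Arguments.
Unset Strict Implicit.
Unset Printing Implicit Defensive.

(** * Ancestors in a forest given by a parent map *)

Section Ancestors.

Variables (V : finType) (f : V -> option V).

Definition anc : rel V := connect (parent_arc f).

Lemma anc_parent u v : f v = Some u -> anc u v.
Proof. by move=> fv; apply: connect1; rewrite /parent_arc fv. Qed.

Lemma anc_ind (P : V -> Prop) y :
  P y -> (forall u v, f v = Some u -> anc v y -> P v -> P u) ->
  forall x, anc x y -> P x.
Proof.
move=> Py step x /connectP[p]; elim: p x => [|a p IHp] x /= => [_ <- //|].
case/andP=> /eqP fa pth Ey; apply: (step x a fa); last exact: IHp pth Ey.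
by apply/connectP; exists p.
Qed.

Lemma ancP x y : anc x y -> x = y \/ exists2 w, f y = Some w & anc x w.
Proof.
case/connectP=> p; case: (lastP p) => [_ -> | q a]; first by left.
rewrite rcons_path last_rcons => /andP[pth /eqP fa] ->; right.
by exists (last x q) => //; apply/connectP; exists q.
Qed.

End Ancestors.

(** * Invariants of depth-first search *)

Section DepthFirstSearch.

Variables (V : finType) (A : rel V) (s : V).

(** With an empty stack, [inv_done] says that arcs to later vertices lead to descendants, and
    [inv_interval] that descendants are consecutive in preorder; [inv_active] carries both through
    the induction. *)
Record dfs_inv (stk ord : seq V) (f : V -> option V) : Prop := DfsInv {
  inv_uniq : uniq ord;
  inv_root : f s = None;
  inv_start : s \in ord;
  inv_stack : {subset stk <= ord};
  inv_sorted : sorted (fun x y => index y ord < index x ord) stk;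
  inv_parent : forall u v, f v = Some u ->
    [/\ A u v, u \in ord, v \in ord & index u ord < index v ord];
  inv_some : forall v, v \in ord -> v != s -> isSome (f v);
  inv_stack_parent : forall u v, v \in stk -> f v = Some u -> u \in stk;
  inv_active : forall p q, p \in stk -> q \in ord ->
    index p ord <= index q ord -> anc f p q;
  inv_done : forall p q, p \in ord -> p \notin stk -> A p q ->
    q \in ord /\ (index p ord <= index q ord -> anc f p q);
  inv_interval : forall x p q, anc f x p -> p \in ord ->
    index x ord <= index q ord -> index q ord <= index p ord -> anc f x q
}.

Lemma index_rcons_mem (T : eqType) (l : seq T) (v w : T) :
  w \in l -> index w (rcons l v) = index w l.
Proof. by move=> wl; rewrite -cats1 index_cat wl. Qed.

Lemma index_rcons_last (T : eqType) (l : seq T) (v : T) :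
  v \notin l -> index v (rcons l v) = size l.
Proof. by move=> /negbTE vl; rewrite -cats1 index_cat vl /= eqxx addn0. Qed.

Lemma stack_top_index (stk ord : seq V) u w :
  sorted (fun x y => index y ord < index x ord) (u :: stk) -> w \in stk ->
  index w ord < index u ord.
Proof.
move=> /= srt wstk.
have tr : transitive (fun x y => index y ord < index x ord).
  by move=> a b c ba ac; apply: ltn_trans ac ba.
by move/(order_path_min tr)/allP: srt => /(_ w wstk).
Qed.

Lemma dfs_inv_start : dfs_inv [:: s] [:: s] (fun=> None).
Proof.
split=> //=; rewrite ?inE ?eqxx //.
- by move=> v; rewrite inE => ->.
- by move=> p q; rewrite !inE => /eqP-> /eqP-> _; apply: connect0.
- by move=> p q; rewrite !inE => ->.
- move=> x p q /ancP[->|[w]] //; rewrite inE => /eqP-> /=.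
  rewrite eqxx; case: (eqVneq s q) => [->|] // _ _; exact: connect0.
Qed.

Lemma dfs_inv_advance u v stk ord f :
  dfs_inv (u :: stk) ord f -> A u v -> v \notin ord ->
  dfs_inv [:: v, u & stk] (rcons ord v) (set_parent f v (Some u)).
Proof.
move=> inv Auv vord; set f' := set_parent _ _ _; set ord' := rcons _ _.
have uord : u \in ord by apply: (inv_stack inv); rewrite inE eqxx.
have ne w : w \in ord -> (w == v) = false.
  by move=> wo; apply: contraNF vord => /eqP<-.
have fv : f v = None.
  by case E: (f v) => [w|//]; case: (inv_parent inv E); rewrite (negPf vord).
have f'E w : w != v -> f' w = f w by rewrite /f' /set_parent => /negbTE->.
have f'v : f' v = Some u by rewrite /f' /set_parent eqxx.
have up x p : anc f x p -> anc f' x p.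
  apply: connect_sub => a b /eqP fb; apply: anc_parent.
  by rewrite f'E //; apply/eqP=> bv; rewrite bv fv in fb.
(* [v] is the parent of no vertex, so a path ending elsewhere avoids [v] and the added arc. *)
have down x p : p != v -> anc f' x p -> anc f x p.
  move=> pv; have K : anc f p p by apply: connect0.
  suff: forall x, anc f' x p -> anc f x p /\ x != v by move=> H /H[].
  apply: (anc_ind (P := fun x => anc f x p /\ x != v)) => // a b fb _ [ap bv].
  rewrite f'E // in fb; split; first exact: connect_trans (anc_parent fb) ap.
  by case: (inv_parent inv fb) => _ /ne->.
have io w : w \in ord -> index w ord' = index w ord by exact: index_rcons_mem.
have iv : index v ord' = size ord by exact: index_rcons_last.
have lt w : w \in ord -> index w ord < size ord by rewrite index_mem.
have mem' w : w \in ord' -> w = v \/ w \in ord.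
  by rewrite mem_rcons inE => /orP[/eqP|]; [left|right].
have sub w : w \in ord -> w \in ord' by move=> H; rewrite mem_rcons inE H orbT.
have vord' : v \in ord' by rewrite mem_rcons inE eqxx.
have small w : index w ord' < size ord -> w \in ord.
  move=> H; case: (mem' w); rewrite -?index_mem ?size_rcons //.
    exact: ltnW.
  by move=> E; move: H; rewrite E iv ltnn.
split.
- by rewrite rcons_uniq vord (inv_uniq inv).
- by rewrite f'E ?(inv_root inv) // ne // (inv_start inv).
- exact/sub/(inv_start inv).
- move=> w; rewrite inE => /orP[/eqP->//|/(inv_stack inv)]; exact: sub.
- rewrite /sorted /= io // iv lt //=.
  have := inv_sorted inv; rewrite /= => srt.
  rewrite (@eq_in_path _ (mem ord) _ (fun x y => index y ord < index x ord)) //.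
    by move=> a b ao bo /=; rewrite !io.
  by apply/allP=> w /(inv_stack inv).
- move=> a b; case: (eqVneq b v) => [->|bv].
    by rewrite f'v => -[<-]; rewrite io // iv lt // sub.
  rewrite f'E // => /(inv_parent inv)[Aab ao bo ab].
  by rewrite !io // !sub.
- move=> w /mem'[->|wo] ws; first by rewrite f'v.
  by rewrite f'E ?ne //; apply: (inv_some inv).
- move=> a b; rewrite inE => /orP[/eqP->|bstk].
    by rewrite f'v => -[<-]; rewrite !inE eqxx orbT.
  have bo : b \in ord by apply: (inv_stack inv).
  rewrite f'E ?ne // => /(inv_stack_parent inv bstk) astk.
  by rewrite inE astk orbT.
- move=> p q; rewrite inE => /orP[/eqP->|pstk] /mem'[->|qo].
  + by move=> _; apply: connect0.
  + by rewrite iv io // leqNgt lt.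
  + move=> _; apply: connect_trans (anc_parent f'v); apply: up.
    apply: (inv_active inv) => //; move: pstk; rewrite inE => /orP[/eqP->//|].
    by move=> pstk; apply/ltnW/(stack_top_index (inv_sorted inv)).
  + by rewrite (io _ (inv_stack inv pstk)) io // => le; apply/up/(inv_active inv).
- move=> p q /mem'[->|po]; first by rewrite inE eqxx.
  rewrite inE negb_or => /andP[_ pstk] /(inv_done inv po pstk)[qo H].
  by rewrite sub // !io //; split=> // /H; apply: up.
- move=> x p q xp /mem' pP xq qp; case: pP xp qp => [->|po] xp qp; last first.
    have pv : p != v by rewrite ne.
    rewrite (io p po) in qp.
    have qo : q \in ord by exact: small _ (leq_ltn_trans qp (lt _ po)).
    have xo : x \in ord.
      exact: small _ (leq_ltn_trans (leq_trans xq qp) (lt _ po)).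
    rewrite !io // in xq qp.
    by apply: up; apply: (inv_interval inv) (down _ _ pv xp) po xq qp.
  case: (eqVneq q v) => [->//|qv].
  have qo : q \in ord.
    case: (mem' q) => //; last by move/eqP; rewrite (negbTE qv).
    by rewrite -index_mem; apply: (leq_ltn_trans qp); rewrite index_mem.
  case: (ancP xp) => [xv|[w]]; first by move: xq; rewrite xv iv io // leqNgt lt.
  rewrite f'v => -[<-] /down-/(_ (negbT (ne _ uord))) xu.
  (* The stack is closed under parents, so ancestors of [u] are active and [inv_active] applies to
     [x]. *)
  have xstk : x \in u :: stk.
    apply: (@anc_ind _ f (fun z => z \in u :: stk) u) xu; first by rewrite inE eqxx.
    by move=> a b fb _ bstk; apply: (inv_stack_parent inv) bstk fb.
  rewrite (io _ (inv_stack inv xstk)) io // in xq.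
  by apply/up/(inv_active inv).
Qed.

(** A popped vertex has all its out-neighbours visited, so [inv_done] for it is [inv_active] read
    just before the pop. *)
Lemma dfs_inv_retreat u stk ord f :
  dfs_inv (u :: stk) ord f -> (forall v, A u v -> v \in ord) ->
  dfs_inv stk ord f.
Proof.
move=> inv Au.
have ustk w : w \in stk -> w \in u :: stk by rewrite inE orbC => ->.
split; try by case: inv.
- by move=> w /ustk/(inv_stack inv).
- by case: inv => _ _ _ _ /path_sorted.
- move=> a b bstk fb; have := inv_stack_parent inv (ustk _ bstk) fb.
  rewrite inE => /orP[/eqP au|//].
  case: (inv_parent inv fb) => _ _ _; rewrite au ltnNge leq_eqVlt.
  by rewrite (stack_top_index (inv_sorted inv) bstk) orbT.
- by move=> p q /ustk; apply: (inv_active inv).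
- move=> p q po pstk Apq; case: (eqVneq p u) => [pu|pu].
    rewrite pu in Apq *; split=> [|le]; first exact: Au.
    by apply: (inv_active inv); rewrite ?inE ?eqxx ?Au.
  by apply: (inv_done inv); rewrite ?inE ?negb_or ?pu.
Qed.

Lemma dfs_run_inv stk ord f : dfs_run A s stk ord f -> dfs_inv stk ord f.
Proof.
elim=> [|u v {}stk {}ord {}f _|u {}stk {}ord {}f _].
- exact: dfs_inv_start.
- exact: dfs_inv_advance.
- exact: dfs_inv_retreat.
Qed.

Lemma dfs_tree_all ord f :
  (forall v, connect A s v) -> dfs_tree A s ord f -> forall v, v \in ord.
Proof.
move=> reach /dfs_run_inv inv v; case/connectP: (reach v) => p.
elim/last_ind: p v => [|p a IHp] v /=; first by move=> _ ->; apply: inv_start inv.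
rewrite rcons_path last_rcons => /andP[pth Apa] ->.
by case: (inv_done inv (IHp _ pth erefl) _ Apa).
Qed.

End DepthFirstSearch.

Record search_tree (V : finType) (A : rel V) (s : V) (ord : seq V)
    (f : V -> option V) : Prop := SearchTree {
  preorder_inj : injective (preorder ord);
  parent_root : f s = None;
  parent_some : forall v, v != s -> isSome (f v);
  parent_lt : forall u v, f v = Some u -> A u v /\ preorder ord u < preorder ord v;
  forward_arc : forall u v, A u v -> preorder ord u <= preorder ord v -> anc f u v;
  anc_interval : forall x y z, anc f x y -> preorder ord x <= preorder ord z ->
    preorder ord z <= preorder ord y -> anc f x z
}.

Lemma dfs_tree_search_tree (V : finType) (A : rel V) (s : V) (ord : seq V)
    (f : V -> option V) :
  flow_graph A s -> dfs_tree A s ord f -> search_tree A s ord f.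
Proof.
move=> [_ _ reach] dfs; have all_ord := dfs_tree_all reach dfs.
have inv := dfs_run_inv dfs; split.
- by move=> x y [/(index_inj s (all_ord x) (all_ord y))].
- exact: inv_root inv.
- by move=> v; apply: (inv_some inv).
- by move=> u v /(inv_parent inv)[].
- by move=> u v /(inv_done inv (all_ord u) isT)[_ H] /H.
- by move=> x y z xy; apply: (inv_interval inv) xy (all_ord y).
Qed.

(** * Subtrees of the search tree and paths above a vertex *)

Section SemiDominators.

Variables (V : finType) (A : rel V) (s : V) (ord : seq V) (f : V -> option V).
Hypothesis tree : search_tree A s ord f.

Local Notation pre := (preorder ord).
Local Notation anc := (anc f).

Lemma anc_le x y : anc x y -> pre x <= pre y.
Proof.
apply: (anc_ind (P := fun x => pre x <= pre y)) => // u v fv _.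
by apply: leq_trans; have [_ /ltnW] := parent_lt tree fv.
Qed.

Lemma anc_comparable x y z : anc x z -> anc y z -> pre x <= pre y -> anc x y.
Proof. by move=> xz yz xy; apply: (anc_interval tree) xz xy _; apply: anc_le. Qed.

Lemma anc_root v : anc s v.
Proof.
have [n] := ubnP (pre v); elim: n v => // n IHn v; rewrite ltnS => ltv.
case: (eqVneq v s) => [->|vs]; first exact: connect0.
case E: (f v) (parent_some tree vs) => [u|] // _.
have [_ uv] := parent_lt tree E.
by apply: connect_trans (anc_parent E); apply: IHn; apply: leq_trans uv ltv.
Qed.

Lemma lt_neq_root x y : pre x < pre y -> y != s.
Proof.
move=> xy; apply/eqP=> ys; have := anc_le (anc_root x).
by rewrite -ys leqNgt xy.
Qed.

(** An arc out of the subtree of [x] ends at a number smaller than [x]: forward arcs stay inside by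
    [forward_arc], backward arcs ending at or after [x] by the interval property. *)
Lemma anc_arc x u v : anc x u -> A u v -> pre x <= pre v -> anc x v.
Proof.
move=> xu Auv xv; have [uv|/ltnW vu] := leqP (pre u) (pre v).
  exact: connect_trans xu (forward_arc tree Auv uv).
exact: (anc_interval tree) xu xv vu.
Qed.

Lemma anc_path x u p :
  anc x u -> path A u p -> all (fun w => pre x <= pre w) p -> anc x (last u p).
Proof.
elim: p u => //= v p IHp u xu /andP[Auv pth] /andP[xv all_p].
by apply: IHp => //; apply: anc_arc xu Auv xv.
Qed.

(* The path is z, q, v: only q is required to lie above v. *)
Definition reaches_above (v z : V) : Prop :=
  exists2 q, path A z (rcons q v) & all (fun w => pre v < pre w) q.

Lemma reaches_above_cons v z y :
  A z y -> pre v < pre y -> reaches_above v y -> reaches_above v z.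
Proof. by move=> Azy vy [q pth all_q]; exists (y :: q); rewrite /= ?Azy ?vy. Qed.

Lemma reaches_above_anc v z y :
  anc z y -> pre v < pre z -> reaches_above v y -> reaches_above v z.
Proof.
move=> zy vz vy; have K x : anc x y -> pre v < pre x -> reaches_above v x.
  apply: (anc_ind (P := fun x => pre v < pre x -> reaches_above v x)) => //.
  move=> u w fw _ IH vu; have [Auw uw] := parent_lt tree fw.
  by apply: reaches_above_cons Auw _ (IH _); apply: ltn_trans uw.
exact: K.
Qed.

(** On a high path, strictness before [x] makes the prefix a high path to [x], and the weak bound
    keeps the suffix in the subtree of [x]. *)
Lemma first_min_split (p : seq V) : p != [::] ->
  exists p1 x p2, [/\ p = p1 ++ x :: p2, all (fun w => pre x < pre w) p1
                    & all (fun w => pre x <= pre w) p2].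
Proof.
elim: p => // y p IHp _; case: (eqVneq p [::]) => [->|/IHp].
  by exists [::], y, [::].
move=> [p1 [x [p2 [-> a1 a2]]]]; have [yx|xy] := leqP (pre y) (pre x).
  exists [::], y, (p1 ++ x :: p2); split=> //.
  rewrite all_cat /= yx; apply/and3P; split=> //.
    by apply: sub_all a1 => w; apply/leq_trans/ltnW.
  by apply: sub_all a2 => w; apply: leq_trans.
by exists (y :: p1), x, p2; rewrite /= xy.
Qed.

(** * Semi-dominators, relative dominators and the arcs from [g] *)

Variables (sd rd g : V -> V).
Hypothesis sdP : forall v, v != s -> is_semidominator A ord v (sd v).
Hypothesis rdP : forall v, v != s -> is_relative_dominator ord f sd v (rd v).
Hypothesis gP : forall v, v != s -> is_last_high_arc A ord (sd v) v (g v).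

Lemma sd_le_parent u v : f v = Some u -> pre (sd v) <= pre u.
Proof.
move=> fv; have [Auv /lt_neq_root vs] := parent_lt tree fv.
by have [_ /(_ u [::])] := sdP vs; rewrite /high_path /= Auv; apply.
Qed.

Lemma sd_lt v : v != s -> pre (sd v) < pre v.
Proof.
move=> vs; case E: (f v) (parent_some tree vs) => [u|] // _.
by have [_ uv] := parent_lt tree E; apply: leq_ltn_trans uv; apply: sd_le_parent.
Qed.

(** A high path to [v] has no vertex smaller than [sd v], so it stays in the subtree of its
    start. *)
Lemma sd_anc v : v != s -> anc (sd v) v.
Proof.
move=> vs; have [[p /andP[pth /allP all_p]] _] := sdP vs.
rewrite -[X in anc _ X](last_rcons (sd v) p); apply: (anc_path (connect0 _ _) pth).
rewrite all_rcons ltnW ?sd_lt //=; apply/allP=> w /all_p/andP[+ _].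
exact: ltnW.
Qed.

(** If [sd z] is smaller than [v], a high path to [z] followed by [q] is a high path from [sd z] to
    [v]; otherwise [sd v < v] suffices. *)
Lemma sd_le_reaches v z : v != s -> pre v < pre z -> reaches_above v z ->
  pre (sd v) <= pre (sd z).
Proof.
move=> vs vz [q pth_q all_q]; have zs := lt_neq_root vz.
have [vsz|szv] := leqP (pre v) (pre (sd z)).
  by apply: leq_trans vsz; apply/ltnW/sd_lt.
have [_ sd_min] := sdP vs; have [[p /andP[pth_p all_p]] _] := sdP zs.
apply: (sd_min _ (rcons p z ++ q)); rewrite /high_path rcons_cat cat_path pth_p.
rewrite last_rcons pth_q all_cat all_rcons sd_lt // vz /=; apply/andP; split.
  by apply: sub_all all_p => w /andP[-> /(ltn_trans vz)].
by apply: sub_all all_q => w vw; rewrite vw (ltn_trans szv).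
Qed.

Lemma g_arc v : v != s -> A (g v) v.
Proof.
by move=> vs; have [p /andP[+ _] ->] := gP vs; rewrite rcons_path => /andP[].
Qed.

(** If the high path has interior vertices, let [x] be the first smallest one. The suffix keeps
    [g v] in the subtree of [x]. The prefix is high, so [sd x <= sd v]; the suffix stays above [v],
    which gives the converse. *)
Lemma gE v : v != s -> g v = sd v \/
  pre v < pre (g v) /\ exists x, [/\ anc x (g v), pre v < pre x & sd x = sd v].
Proof.
move=> vs; have [p /andP[pth all_p] ->] := gP vs.
case: (eqVneq p [::]) => [->|p0]; [by left | right].
have lt_p w : w \in p -> pre v < pre w by move/allP: all_p => /[apply]/andP[].
split; first by case: (p) p0 lt_p => // a q _ /(_ _ (mem_last a q)).
have [p1 [x [p2 [pE a1 a2]]]] := first_min_split p0.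
have vx : pre v < pre x by apply: lt_p; rewrite pE mem_cat inE eqxx orbT.
have xs := lt_neq_root vx.
move: pth; rewrite pE rcons_cat cat_path /= => /and3P[pth1 A1x pth2].
exists x; split=> //.
  rewrite last_cat /=; apply: (anc_path (connect0 _ _) _ a2).
  by move: pth2; rewrite rcons_path => /andP[].
apply: (preorder_inj tree); apply/eqP; rewrite eqn_leq; apply/andP; split.
  have [_ sd_min] := sdP xs; apply: (sd_min _ p1).
  rewrite /high_path rcons_path pth1 A1x /=; apply/allP=> w wp1.
  rewrite (allP a1) // andbT (ltn_trans (sd_lt vs)) // lt_p //.
  by rewrite pE mem_cat wp1.
apply: sd_le_reaches => //; exists p2 => //.
by apply/allP=> w wp2; apply: lt_p; rewrite pE mem_cat inE wp2 !orbT.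
Qed.

(* The order in which [rd v] is the least element of F(sd v, v]. *)
Definition beats (x y : V) : Prop :=
  pre (sd x) < pre (sd y) \/ pre (sd x) = pre (sd y) /\ pre x <= pre y.

Lemma beats_sd_le x y : beats x y -> pre (sd x) <= pre (sd y).
Proof. by case=> [/ltnW|[-> _]]. Qed.

Lemma beats_le x y : beats x y -> pre (sd y) <= pre (sd x) -> pre x <= pre y.
Proof. by case=> [|[_ ->] //]; rewrite ltnNge => /negbTE->. Qed.

Lemma on_tree_pathE v x : v != s ->
  on_tree_path f (sd v) v x <-> anc x v /\ pre (sd v) < pre x.
Proof.
move=> vs; split=> [[c [/eqP fc cx xv]]|[xv lt]].
  by split=> //; have [_ /leq_trans-> //] := parent_lt tree fc; apply: anc_le.
have ax : anc (sd v) x by apply: anc_comparable (sd_anc vs) xv (ltnW lt).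
case/connectP: ax => -[|c p] /=; first by move=> _ E; rewrite E ltnn in lt.
by case/andP=> fc pth E; exists c; split=> //; apply/connectP; exists p.
Qed.

Lemma rd_anc v : v != s -> anc (rd v) v.
Proof. by move=> vs; have [/on_tree_pathE-/(_ vs)[]] := rdP vs. Qed.

Lemma sd_lt_rd v : v != s -> pre (sd v) < pre (rd v).
Proof. by move=> vs; have [/on_tree_pathE-/(_ vs)[]] := rdP vs. Qed.

Lemma rd_beats v y : v != s -> anc y v -> pre (sd v) < pre y -> beats (rd v) y.
Proof.
move=> vs yv lt; have [_ /(_ y)] := rdP vs.
by case=> [|?|[E ?]]; [exact/on_tree_pathE | left | right; rewrite E].
Qed.

Lemma sd_rd_le v : v != s -> pre (sd (rd v)) <= pre (sd v).
Proof.
by move=> vs; apply: beats_sd_le (rd_beats vs (connect0 _ v) (sd_lt vs)).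
Qed.

(** * Monotonicity of the choice along relative dominators *)

(** Made so that F([sd x], [x]] passes through [v] without its minimum lying strictly below [v] in
    the tree; tree paths from the smallest vertex [v] of a cycle to the cycle supply such [x]. *)
Definition extends (v x : V) : Prop :=
  [/\ anc v x, pre (sd x) < pre v
    & forall z, anc v z -> anc z x -> pre (sd v) <= pre (sd z)].

Lemma extends_sd_le v x : extends v x -> pre (sd v) <= pre (sd x).
Proof. by case=> vx _ H; apply: H => //; apply: connect0. Qed.

Lemma extends_neq_root v x : v != s -> extends v x -> x != s.
Proof.
by move=> /sd_lt lt [/anc_le vx _ _]; apply: lt_neq_root (leq_trans lt vx).
Qed.

(** [rd x] beats [v]; if it lay strictly below [v], the third condition would force a tie in [sd],
    which [v] wins by its smaller number. *)
Lemma extends_rd v x : v != s -> extends v x ->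
  anc (rd x) v /\ pre (sd (rd x)) <= pre (sd v).
Proof.
move=> vs ext; have xs := extends_neq_root vs ext; case: ext => vx sxv H.
have bv := rd_beats xs vx sxv; split; last exact: beats_sd_le.
have rx := rd_anc xs; apply: (anc_comparable rx vx).
case/orP: (leq_total (pre (rd x)) (pre v)) => // lt.
exact: beats_le bv (H _ (anc_comparable vx rx lt) rx).
Qed.

(** With equal semi-dominators, [rd x] and [rd v] each lie on the path minimised by the other, so
    each beats the other. *)
Lemma extends_rd_eq v x : v != s -> extends v x -> sd x = sd v -> rd x = rd v.
Proof.
move=> vs ext sxv; have xs := extends_neq_root vs ext.
have [rxv _] := extends_rd vs ext; case: ext => vx _ _.
have lt_x := sd_lt_rd xs; have lt_v := sd_lt_rd vs; rewrite sxv in lt_x.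
have b1 := rd_beats vs rxv lt_x.
have b2 : beats (rd x) (rd v).
  by apply: rd_beats; rewrite ?sxv //; apply: connect_trans (rd_anc vs) vx.
apply: (preorder_inj tree); apply/eqP; rewrite eqn_leq.
by rewrite (beats_le b1) ?(beats_le b2) ?beats_sd_le.
Qed.

(* [T v] tells which of the parents [g v] and [f v] the tree B uses at [v]. *)
Variable T : V -> bool.
Hypothesis T_eq : forall v, v != s -> sd (rd v) = sd v -> T v.
Hypothesis T_neq : forall v, v != s -> sd (rd v) <> sd v -> T v = ~~ T (rd v).

Lemma T_lt v : v != s -> pre (sd (rd v)) < pre (sd v) -> T v = ~~ T (rd v).
Proof. by move=> vs lt; apply: T_neq => // E; rewrite E ltnn in lt. Qed.

(* [rd x1] and [rd x2] extend [rd v], which gives the induction. *)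
Lemma T_monotone v x1 x2 : v != s -> extends v x1 -> extends v x2 ->
  pre (sd x1) <= pre (sd x2) -> T x2 = T v -> T x1 = T v.
Proof.
have [n] := ubnP (pre v).
elim: n v x1 x2 => // n IHn v x1 x2; rewrite ltnS => ltv vs e1 e2 le12 T2.
have same x : extends v x -> sd x = sd v -> T x = T v.
  move=> e sxv; have rxv := extends_rd_eq vs e sxv.
  have xs := extends_neq_root vs e.
  case: (eqVneq (sd (rd v)) (sd v)) => [E|/eqP N].
    by rewrite !T_eq ?rxv ?sxv.
  by rewrite (T_neq vs) // (T_neq xs) ?rxv ?sxv.
case: (eqVneq (sd x1) (sd v)) => [/same-> //|ne1].
have lt1 : pre (sd v) < pre (sd x1).
  rewrite ltn_neqAle (extends_sd_le e1) andbT.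
  by apply: contra_neq ne1 => /(preorder_inj tree).
have lt2 := leq_trans lt1 le12.
have xs1 := extends_neq_root vs e1; have xs2 := extends_neq_root vs e2.
have [r1v r1] := extends_rd vs e1; have [r2v r2] := extends_rd vs e2.
have Tx1 := T_lt xs1 (leq_ltn_trans r1 lt1).
have Tx2 := T_lt xs2 (leq_ltn_trans r2 lt2).
have lr1 := sd_lt_rd xs1; have lr2 := sd_lt_rd xs2.
have vr1 := ltn_trans lt1 lr1; have vr2 := ltn_trans lt2 lr2.
(* If [sd (rd v) = sd v], then [T v] holds, and so does [T (rd x2)] since [rd x2] attains the same
   least value; hence [T x2] fails, against [T x2 = T v]. *)
case: (eqVneq (sd (rd v)) (sd v)) => [E|N].
  have rs2 := lt_neq_root vr2.
  have b2 := rd_beats vs r2v vr2.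
  have s2 : pre (sd (rd x2)) = pre (sd v).
    by apply/eqP; rewrite eqn_leq r2 -E beats_sd_le.
  have: T (rd x2).
    apply: T_eq => //; apply: (preorder_inj tree); rewrite s2.
    have lrr := sd_lt_rd rs2; rewrite s2 in lrr.
    have brr := rd_beats vs (connect_trans (rd_anc rs2) r2v) lrr.
    by apply/eqP; rewrite eqn_leq -{1}s2 sd_rd_le // -E beats_sd_le.
  by move: T2; rewrite Tx2 (T_eq vs E) => /negbTE->.
have ltm : pre (sd (rd v)) < pre (sd v).
  rewrite ltn_neqAle sd_rd_le // andbT.
  by apply: contra_neq N => /(preorder_inj tree).
have ms := lt_neq_root (sd_lt_rd vs).
(* If [rd x] were smaller than [rd v], then [rd v] would lie on F([sd x], [x]] and each would beat
   the other, putting [rd v] first. *)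
have ext_r x : extends v x -> pre (sd v) < pre (sd x) -> extends (rd v) (rd x).
  move=> e ltx; have xs := extends_neq_root vs e; have [rv r] := extends_rd vs e.
  have lr := sd_lt_rd xs; have br := rd_beats vs rv (ltn_trans ltx lr).
  split.
  - apply: anc_comparable (rd_anc vs) rv _; rewrite leqNgt; apply/negP => lt.
    have vx : anc v x by case: e.
    have b := rd_beats xs (connect_trans (rd_anc vs) vx) (ltn_trans lr lt).
    by have := beats_le br (beats_sd_le b); rewrite leqNgt lt.
  - exact: leq_ltn_trans r (sd_lt_rd vs).
  - move=> z mz zr; apply/beats_sd_le/rd_beats => //.
      exact: connect_trans zr rv.
    exact: leq_trans (sd_lt_rd vs) (anc_le mz).
(* [rd x2] is an ancestor of [x1] and exceeds [sd x2 >= sd x1], so it competes in the choice of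
   [rd x1]. *)
have le_r : pre (sd (rd x1)) <= pre (sd (rd x2)).
  have vx : anc v x1 by case: e1.
  apply/beats_sd_le/rd_beats => //; first exact: connect_trans r2v vx.
  exact: leq_ltn_trans le12 lr2.
have Tv := T_lt vs ltm; rewrite Tx1 Tv; congr (~~ _).
apply: (IHn (rd v) _ (rd x2)); rewrite ?ext_r //; try exact: ext_r.
- apply: leq_trans ltv; rewrite ltn_neqAle anc_le ?rd_anc // andbT.
  by apply: contra_neq N => /(preorder_inj tree)->.
- by apply: negb_inj; rewrite -Tx2 -Tv.
Qed.

(* [c = true] gives the parent map of B, [c = false] that of R. *)
Variable c : bool.

(** A total map, so that chains of parents are iterates; the default arises only at the root. *)
Definition choice_parent (y : V) : V :=
  if T y == c then g y else odflt y (f y).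

Local Notation h := choice_parent.

Lemma choice_parent_arc y : y != s -> A (h y) y.
Proof.
move=> ys; rewrite /h; case: ifP => _; first exact: g_arc.
case E: (f y) (parent_some tree ys) => [u|] //= _.
by have [] := parent_lt tree E.
Qed.

(** * A cycle of chosen arcs with smallest vertex [v] *)

Section MinimalVertexOnCycle.

Variables (v : V) (k : nat).
Hypothesis k_gt0 : 0 < k.
Hypothesis iter_k : iter k h v = v.
Hypothesis iter_neq : forall i, iter i h v != s.
Hypothesis iter_min : forall i, pre v <= pre (iter i h v).

Let vs : v != s := iter_neq 0.

(** [h] runs against the arcs, so the induction counts the steps [j] of [h] left before returning to
    [v]; no vertex is smaller than [v], so each arc stays in its subtree. *)
Lemma cycle_anc i : anc v (iter i h v).
Proof.
have back j : forall i, iter j h (iter i h v) = v -> anc v (iter i h v).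
  elim: j => [|j IHj] {}i; first by move=> /= ->; apply: connect0.
  rewrite iterSr => /(IHj i.+1) vi.
  exact: anc_arc vi (choice_parent_arc (iter_neq i)) (iter_min i).
(* [i * k] steps return to [v], and [i <= i * k] because [k] is positive. *)
apply: (back (i * k - i)); rewrite -iterD subnK ?leq_pmulr // iterM.
by elim: (i) => //= j ->.
Qed.

Lemma cycle_reaches i : iter i h v != v -> reaches_above v (iter i h v).
Proof.
elim: i => [|i IHi]; first by rewrite eqxx.
have arc := choice_parent_arc (iter_neq i) => /= _.
case: (eqVneq (iter i h v) v) => [E|ne].
  by exists [::]; rewrite //= andbT -[X in A _ X]E.
apply: reaches_above_cons arc _ (IHi ne); rewrite ltn_neqAle iter_min andbT.
by apply: contra_neq ne => /(preorder_inj tree).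
Qed.

Lemma cycle_sd_le z i : pre v < pre z -> anc z (iter i h v) ->
  pre (sd v) <= pre (sd z).
Proof.
move=> vz zi; apply: sd_le_reaches => //; apply: (reaches_above_anc zi vz).
apply: cycle_reaches; apply/eqP=> E; rewrite E in zi.
by have := anc_le zi; rewrite leqNgt vz.
Qed.

Lemma cycle_extends x i : pre v < pre x -> anc x (iter i h v) ->
  pre (sd x) < pre v -> extends v x.
Proof.
move=> vx xi sxv; split=> //; first exact: anc_comparable (cycle_anc i) xi (ltnW vx).
move=> z vz zx; case: (eqVneq z v) => [-> //|ne].
apply: (@cycle_sd_le _ i); last exact: connect_trans zx xi.
rewrite ltn_neqAle anc_le // andbT eq_sym.
by apply: contra_neq ne => /(preorder_inj tree).
Qed.

(** Otherwise the next iterate is [f v], smaller than [v]. *)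
Lemma cycle_T : T v = c.
Proof.
apply/eqP; apply: contraT => ne; have := iter_min 1; rewrite /= /h (negbTE ne).
case E: (f v) (parent_some tree vs) => [u|] //= _.
by have [_] := parent_lt tree E; rewrite ltnNge => /negbTE->.
Qed.

Definition blocked (y : V) : Prop :=
  exists x, [/\ anc x y, pre v < pre x, pre (sd x) < pre v & T x = c].

(** The parent chosen at [v] is [g v], and not [sd v], which is smaller than [v]. The vertex [x]
    from [gE] has [sd x = sd v], and monotonicity compares it with [v] itself. *)
Lemma blocked_start : blocked (iter 1 h v).
Proof.
have le := iter_min 1; have ext x := @cycle_extends x 1; move: le ext.
rewrite /= /h cycle_T eqxx => le ext.
have [E|[_ [x [xg vx sxv]]]] := gE vs.
  by move: le; rewrite E leqNgt sd_lt.
have sx : pre (sd x) < pre v by rewrite sxv sd_lt.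
have e := ext x vx xg sx.
have ev : extends v v.
  split; [exact: connect0 | exact: sd_lt|] => z vz zv.
  suff -> : z = v by [].
  by apply: (preorder_inj tree); apply/eqP; rewrite eqn_leq !anc_le.
exists x; split=> //; rewrite -cycle_T.
by apply: (T_monotone (x2 := v)) => //; rewrite sxv.
Qed.

(** [x] lies on F([sd y], [y]], so [sd (rd y) <= sd x], and both [rd y] and [x] extend [v].
    Monotonicity gives [T (rd y) = c], and [sd (rd y) < v <= sd y] makes [T y] its negation. *)
Lemma blocked_rd y i x : y = iter i h v -> anc x y -> pre v < pre x ->
  pre (sd x) < pre v -> T x = c -> pre v <= pre (sd y) -> pre (sd y) < pre x ->
  T y <> c.
Proof.
move=> yE xy vx sxv Tx vsy syx Ty; have ys : y != s by rewrite yE.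
have lt := sd_lt_rd ys; have ry := rd_anc ys.
have le : pre (sd (rd y)) <= pre (sd x) by apply/beats_sd_le/rd_beats.
have Tr : T (rd y) = T v.
  apply: (T_monotone vs (x2 := x)) => //; last by rewrite Tx cycle_T.
    apply: (cycle_extends (i := i)); first exact: leq_ltn_trans vsy lt.
      by rewrite -yE.
    exact: leq_ltn_trans le sxv.
  by apply: (cycle_extends (i := i)); rewrite -?yE.
have: T y = ~~ T (rd y).
  by apply: T_lt => //; apply: leq_trans vsy; apply: leq_ltn_trans le sxv.
by rewrite Ty Tr cycle_T; case: (c).
Qed.

Lemma blocked_step i : blocked (iter i h v) -> blocked (iter i.+1 h v).
Proof.
move=> [x [xy vx sxv Tx]]; have min' := iter_min i.+1.
have ext x1 := @cycle_extends x1 i; have ext' x1 := @cycle_extends x1 i.+1.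
have noT := @blocked_rd _ i x erefl xy vx sxv Tx.
move: min' xy ext ext' noT (iter_neq i); rewrite iterS.
set y := iter i h v => min' xy ext ext' noT ys.
move: min' ext'; rewrite /h; case: eqP => [Ty|Ty] min' ext'; last first.
  exists x; split=> //; have [xE|[w fy xw]] := ancP xy; first by rewrite -xE Tx in Ty.
  by rewrite fy.
(* When [g y = sd y], either [x] is still an ancestor of [sd y] or [blocked_rd] contradicts
   [T y = c]. *)
have [gsd|[_ [x' [xg yx' sx']]]] := gE ys.
  rewrite gsd in min' *; exists x; split=> //.
  have [le|lt] := leqP (pre x) (pre (sd y)); last by case: (noT min' lt).
  exact: anc_comparable xy (sd_anc ys) le.
have [xgy|/negP nxg] := boolP (anc x (g y)); first by exists x.
have vx' : pre v < pre x' by apply: ltn_trans yx'; apply: leq_trans vx (anc_le xy).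
have x's := lt_neq_root vx'.
have syg : anc (sd y) (g y) by rewrite -sx'; apply: connect_trans (sd_anc x's) xg.
have syx : pre (sd y) < pre x.
  rewrite ltnNge; apply/negP => le; apply: nxg; apply: connect_trans syg.
  exact: anc_comparable xy (sd_anc ys) le.
have [vsy|syv] := leqP (pre v) (pre (sd y)); first by case: (noT vsy syx).
have vy : pre v < pre y by apply: leq_trans vx (anc_le xy).
(* Here [sd y] is smaller than [v], so [y] extends [v], and [x'], with the same semi-dominator,
   inherits [T y = T v]. *)
exists x'; split; rewrite ?sx' //; rewrite -cycle_T.
apply: (T_monotone vs (x2 := y)); rewrite ?sx' //.
- by apply: ext'; rewrite ?sx'.
- by apply: ext => //; apply: connect0.
- by rewrite Ty cycle_T.
Qed.

Lemma no_minimal_cycle : False.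
Proof.
have: blocked (iter k h v).
  case: k k_gt0 => // j _; elim: j => [|j]; first exact: blocked_start.
  exact: blocked_step.
by rewrite iter_k => -[x [/anc_le + + _ _]]; rewrite leqNgt => /negP.
Qed.

End MinimalVertexOnCycle.

(** * From acyclicity to spanning trees *)

(** A chain avoiding the root repeats a vertex by the pigeonhole principle and so contains a
    cycle. *)
Lemma iter_choice_parent_root y : exists i, iter i h y = s.
Proof.
have [/existsP[z /andP[yz /eqP zs]]|none] :=
  boolP [exists z, fconnect h y z && (z == s)].
  by exists (findex h y z); rewrite iter_findex.
have neq i : iter i h y != s.
  apply: contra none => /eqP is_s; apply/existsP; exists (iter i h y).
  by rewrite fconnect_iter is_s eqxx.
have [i [j [lt_ij Eij]]] : exists i j, i < j /\ iter i h y = iter j h y.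
  pose F (i : 'I_#|V|.+1) := iter i h y.
  have /injectivePn[a [b ne E]] : ~~ injectiveb F.
    by apply/injectiveP => /leq_card; rewrite card_ord ltnn.
  case: (ltngtP a b) => [lt|lt|/ord_inj/eqP]; last by rewrite (negbTE ne).
    by exists a, b.
  by exists b, a.
pose y1 := iter i h y.
have per : iter (j - i) h y1 = y1 by rewrite -iterD subnK // ltnW.
(* [y1] is on the cycle already, so its orbit is the cycle and the smallest vertex has the same
   period. *)
have [v y1v vmin] := @arg_minnP V y1 (fconnect h y1) pre (connect0 _ _).
have vE := iter_findex y1v; set n := findex _ _ _ in vE.
exfalso; apply: (@no_minimal_cycle v (j - i)).
- by rewrite subn_gt0.
- by rewrite -vE -iterD addnC iterD per.
- by move=> a; rewrite -vE -!iterD.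
- by move=> a; apply/vmin/(connect_trans y1v)/fconnect_iter.
Qed.

Lemma choice_parent_spanning_tree (p : V -> option V) :
  p s = None -> (forall v, v != s -> p v = Some (h v)) ->
  spanning_tree A s (parent_arc p).
Proof.
move=> ps pE; split.
- move=> u v /eqP pv; have vs : v != s by apply/eqP=> E; rewrite E ps in pv.
  by have := pE v vs; rewrite pv => -[->]; apply: choice_parent_arc.
- by move=> u; rewrite /parent_arc ps.
- move=> v vs; exists (h v); rewrite /parent_arc pE //; split=> //.
  by move=> u /eqP[].
- move=> v; have [i] := iter_choice_parent_root v.
  elim: i v => [|i IHi] v; first by move=> /= ->; apply: connect0.
  case: (eqVneq v s) => [-> _|vs]; first exact: connect0.
  rewrite iterSr => /IHi /connect_trans; apply; apply: connect1.
  by rewrite /parent_arc pE.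
Qed.

End SemiDominators.

(** * The sequential assignment *)

Section Assign.

Variables (V : finType) (s : V) (f : V -> option V) (sd rd g : V -> V).

Lemma foldl_assign_notin l br v : v \notin l ->
  (foldl (assign_step f sd rd g) br l).1 v = br.1 v /\
  (foldl (assign_step f sd rd g) br l).2 v = br.2 v.
Proof.
elim: l br => //= w l IHl br; rewrite inE negb_or => /andP[vw /IHl{}IHl].
have [-> ->] := IHl (assign_step f sd rd g br w).
by case: br => b r /=; case: ifP => _ /=; rewrite /set_parent (negbTE vw).
Qed.

(** [swap] may use the final [b]: if [rd v] precedes [v], its entry is settled before [v] is
    processed and never changes; if [rd v = v], the first disjunct decides. *)
Lemma assignE ord b r v : assign s ord f sd rd g = (b, r) ->
  uniq ord -> v \in ord -> v != s ->
  rd v = v \/ index (rd v) ord < index v ord ->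
  let swap := (sd v == sd (rd v)) || (b (rd v) == f (rd v)) in
  b v = (if swap then Some (g v) else f v) /\
  r v = (if swap then f v else Some (g v)).
Proof.
rewrite /assign => + uo vo; case/splitPr: vo uo => o1 o2.
rewrite cat_uniq /= negb_or => /and4P[_ /andP[vo1 /hasPn dis] vo2 _] + vs.
rewrite filter_cat /= vs foldl_cat /=; case: (foldl _ _ (filter _ o1)) => b1 r1 brE.
have not2 w : w \notin o2 -> w \notin [seq v <- o2 | v != s].
  by rewrite mem_filter negb_and orbC => ->.
have [bv rv] := foldl_assign_notin (assign_step f sd rd g (b1, r1) v) (not2 _ vo2).
rewrite brE /= in bv rv; rewrite bv rv => rdv.
suff -> : (sd v == sd (rd v)) || (b (rd v) == f (rd v)) =
          (sd v == sd (rd v)) || (b1 (rd v) == f (rd v)).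
  by case: ifP => _ /=; rewrite /set_parent eqxx.
case: rdv => [->|]; first by rewrite eqxx.
rewrite !index_cat (negbTE vo1) /= eqxx addn0.
case: ifP => [rdo1 _|_]; last by rewrite ltnNge leq_addr.
have rv2 : rd v \notin o2 by apply: contraTN rdo1 => /dis.
have [+ _] := foldl_assign_notin (assign_step f sd rd g (b1, r1) v) (not2 _ rv2).
have ne : rd v == v = false by apply: contraNF vo1 => /eqP<-.
rewrite brE /= => bE; suff -> : b (rd v) = b1 (rd v) by [].
by rewrite bE; case: ifP => _ /=; rewrite /set_parent ne.
Qed.

End Assign.

Theorem theorem36 (V : finType) (A : rel V) (s : V)
    (ord : seq V) (f : V -> option V) (sd rd g : V -> V)
    (b r : V -> option V) :
  flow_graph A s ->
  dfs_tree A s ord f ->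
  (forall v, v != s -> is_semidominator A ord v (sd v)) ->
  (forall v, v != s -> is_relative_dominator ord f sd v (rd v)) ->
  (forall v, v != s -> is_last_high_arc A ord (sd v) v (g v)) ->
  assign s ord f sd rd g = (b, r) ->
  spanning_tree A s (parent_arc b) /\ spanning_tree A s (parent_arc r).
Proof.
move=> flow dfs sdP rdP gP brE.
have tree := dfs_tree_search_tree flow dfs.
have all_ord := dfs_tree_all (flow_reach flow) dfs.
have uniq_ord := inv_uniq (dfs_run_inv dfs).
have [bs rs] : b s = None /\ r s = None.
  have s_notin : s \notin [seq v <- ord | v != s] by rewrite mem_filter eqxx.
  have := foldl_assign_notin f sd rd g (fun=> None, fun=> None) s_notin.
  by rewrite -/(assign s ord f sd rd g) brE.
pose T v := (sd v == sd (rd v)) || (b (rd v) == f (rd v)).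
have valE v : v != s -> b v = (if T v then Some (g v) else f v) /\
                        r v = (if T v then f v else Some (g v)).
  move=> vs; apply: (assignE brE uniq_ord (all_ord v) vs).
  have := anc_le tree (rd_anc tree sdP rdP vs); rewrite leq_eqVlt.
  by case/orP=> [/eqP/(preorder_inj tree)|]; [left | right].
have T_eq v : v != s -> sd (rd v) = sd v -> T v by rewrite /T => _ ->; rewrite eqxx.
have T_neq v : v != s -> sd (rd v) <> sd v -> T v = ~~ T (rd v).
  move=> vs /eqP ne; rewrite {1}/T eq_sym (negbTE ne) /=.
  have lt := sd_lt_rd tree sdP rdP vs; have xs := lt_neq_root tree lt.
  (* For [x = rd v], the test [b x = f x] must be the negation of [T x]. This is immediate if [T x]
     fails; otherwise [g x] and [f x] must differ. *)
  have [-> _] := valE _ xs; case: ifP => _; last by rewrite eqxx.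
  (* If [g x = f x] for [x = rd v], then [sd x = f x >= sd v], against the
     minimality of [sd x]. *)
  apply/eqP=> /esym fx; have [_ gx] := parent_lt tree fx.
  have [gsd|[]] := gE tree sdP gP xs; last by rewrite ltnNge (ltnW gx).
  have le := sd_rd_le tree sdP rdP vs.
  have /ancP[E|[w]] : anc f (sd v) (rd v).
    apply: (anc_comparable tree (sd_anc tree sdP vs) _ (ltnW lt)).
    exact: (rd_anc tree sdP rdP vs).
  - by move: lt; rewrite E ltnn.
  - rewrite fx => -[<-] /(anc_le tree); rewrite gsd => ge; case/negP: ne.
    by apply/eqP/(preorder_inj tree)/eqP; rewrite eqn_leq le ge.
have span c p : p s = None ->
    (forall v, v != s -> p v = if T v == c then Some (g v) else f v) ->
    spanning_tree A s (parent_arc p).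
  move=> ps pE.
  apply: (choice_parent_spanning_tree tree sdP rdP gP T_eq T_neq (c := c)) => //.
  move=> v vs; rewrite pE // /choice_parent; case: ifP => // _.
  by case: (f v) (parent_some tree vs).
split; [apply: (span true) | apply: (span false)] => // v /valE[bE rE].
- by rewrite bE eqb_id.
- by rewrite rE eqbF_neg; case: (T v).
Qed.
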